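(* Let $\Gamma$ be an inverse semigroup satisfying (LC). Then the following are equivalent. (i) There are no nontrivial $<$-closed invariant subsets of $\Gamma^{(0)}$, i.e. the only nonempty $<$-closed invariant subsets of $\Gamma^{(0)}$ are $\{0\}$ and $\Gamma^{(0)}$. (ii) For every $p,q\in\Gamma^{(0)}$ with $p\neq0$, there exist $x_1,\ldots,x_n\in\Gamma$ with $x_j^{-1}x_j\prec p$, $j=1,\ldots,n$, and $q<(x_1x_1^{-1},\ldots,x_nx_n^{-1})$. (iii) $G_m(\Gamma)$ is minimal, i.e. for every $P\in G_m(\Gamma)^{(0)}$ the orbit $\{XX^{-1}:X\in G_m(\Gamma),\,X^{-1}X=P\}$ of $P$ is dense in $G_m(\Gamma)^{(0)}$.
   Context: In an inverse semigroup, $x\prec y$ means $xy^{-1}=xx^{-1}$ (natural partial order; $x$ is then called a precessor of $y$); $\Gamma^{(0)}$ is the set of idempotents. The symbol $0$ denotes the (unique) element $z$ with $z\prec x$ for all $x$, if it exists; conditions ''$\neq0$'' are vacuous otherwise. An element $x$ is minimal if $x\neq0$ and $y\prec x$, $y\ne0$ implies $y=x$. For $n\ge1$ write $x<(x_1,\ldots,x_n)$ if for every $y\prec x$, $y\ne0$, there exist $z\in\Gamma$, $z\neq0$, and $j$ with $z\prec y$ and $z\prec x_j$. A subset $I\subset\Gamma^{(0)}$ is $<$-closed if $p\in\Gamma^{(0)}$ belongs to $I$ whenever $p<(p_1,\ldots,p_n)$ for some $p_1,\ldots,p_n\in I$; it is invariant if $xpx^{-1}\in I$ for all $p\in I$,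 $x\in\Gamma$ with $p\prec x^{-1}x$. A subset $A\subset\Gamma$ is directed if it is nonempty and any two elements of $A$ have a common $\prec$-lower bound in $A$. For directed sets write $A\prec B$ if for every $b\in B$ there is $a\in A$ with $a\prec b$, and $A\sim B$ if $A\prec B$ and $B\prec A$. $\mathcal{O}(\Gamma)$ is the set of $\sim$-classes $[A]$ of directed sets; with $[A][B]=[AB]$ and $[A]^{-1}=[A^{-1}]$ (elementwise) it is an inverse semigroup whose natural order is $[A]\prec[B]\iff A\prec B$. For $x\in\Gamma$ write $x$ also for $[\{x\}]$. $G_u(\Gamma)$ is the groupoid with underlying set $\mathcal{O}(\Gamma)$, the inversion of $\mathcal{O}(\Gamma)$, and product $XY$ defined iff $X^{-1}X=YY^{-1}$. With $U_x=\{X:X\prec x\}$, the sets $U_x\cap U_{x_1}^c\cap\cdots\cap U_{x_n}^c$ ($x_1,\ldots,x_n\prec x$ in $\Gamma$, $n\ge0$) are a basis of the topology of $G_u(\Gamma)$. $G_m(\Gamma)$ is the subgroupoid of minimal elements of $\mathcal{O}(\Gamma)$, with the subspace topology. For a groupoid $G$, $G^{(0)}$ is its unit set. (LC): $\Gamma$ contains a zero; any $x,y\in\Gamma$ having a common precessor not equal to zero have a largest common precessor; and $G_m(\Gamma)^{(0)}$ is closed in $G_u(\Gamma)^{(0)}$. *)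

(* Defs.v *)
From HB Require Import structures.
From mathcomp Require Import all_boot all_classical topology.

Set Implicit Arguments.
Unset Strict Implicit.
Unset Printing Implicit Defensive.

Local Open Scope group_scope.
Local Open Scope quotient_scope.
Local Open Scope classical_set_scope.

(* MathComp's inv needs a unit element, which an inverse semigroup lacks.     *)
HB.mixin Record Semigroup_isInverse T & Semigroup T := {
  sinv : T -> T;
  mulgVg : forall x : T, x * sinv x * x = x;
  mulVgV : forall x : T, sinv x * x * sinv x = sinv x;
  sinv_uniq : forall x y : T, x * y * x = x -> y * x * y = y -> y = sinv x
}.

#[short(type="invSemigroupType")]
HB.structure Definition InvSemigroup :=
  {T of Semigroup_isInverse T & Semigroup T}.

Local Notation "x ^-1" := (sinv x) : group_scope.

Section InvSemigroupDefs.
Variable T : invSemigroupType.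
Implicit Types (x y z p : T) (I : set T).

Definition prec x y : Prop := x * y^-1 = x * x^-1.

Definition idempotents : set T := [set p | p * p = p].

Definition is_zero z : Prop := forall x, prec z x.

(* "x <> 0", which holds for every x when there is no zero *)
Definition nonzero x : Prop := ~ is_zero x.

Definition minimal_elt x : Prop :=
  nonzero x /\ forall y, prec y x -> nonzero y -> y = x.

(* x < (xs 0, ..., xs n), for nonempty tuples only *)
Definition covered x (n : nat) (xs : 'I_n.+1 -> T) : Prop :=
  forall y, prec y x -> nonzero y ->
  exists z, nonzero z /\ exists j, prec z y /\ prec z (xs j).

Definition covered_closed I : Prop :=
  forall p, idempotents p -> forall n (ps : 'I_n.+1 -> T),
  (forall j, I (ps j)) -> covered p ps -> I p.

Definition invariant_set I : Prop :=
  forall p x, I p -> prec p (x^-1 * x) -> I (x * p * x^-1).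

Definition largest_common_precessor x y z : Prop :=
  [/\ prec z x, prec z y & forall w, prec w x -> prec w y -> prec w z].

End InvSemigroupDefs.

Section InvSemigroupTheory.
Variable T : invSemigroupType.
Implicit Types x y z e f : T.

Lemma sinvK : involutive (@sinv T).
Proof. by move=> x; rewrite -(sinv_uniq _ _ (mulVgV x) (mulgVg x)). Qed.

Lemma idem_sinv e : e * e = e -> e^-1 = e.
Proof. by move=> ee; rewrite -(@sinv_uniq T e e) ?ee. Qed.

Lemma idem_comm e f : e * e = e -> f * f = f -> e * f = f * e.
Proof.
have idemM (a b : T) : a * a = a -> b * b = b -> a * b * (a * b) = a * b.
  move=> aa bb; set x := (a * b)^-1.
  have aaA w : w * a * a = w * a by rewrite -mulgA aa.
  have bbA w : w * b * b = w * b by rewrite -mulgA bb.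
  have h1 : a * b * x * a * b = a * b by have := mulgVg (a * b); rewrite mulgA.
  have h2 : x * a * b * x = x by have := mulVgV (a * b); rewrite mulgA.
  have xE : b * x * a = x.
    apply: sinv_uniq; rewrite !mulgA; first by rewrite bbA aaA h1.
    rewrite aaA bbA; have -> : b * x * a * b * x * a = b * (x * a * b * x) * a.
      by rewrite !mulgA.
    by rewrite h2.
  have xx : x * x = x.
    have -> : x * x = b * (x * a * b * x) * a by rewrite -{1 2}xE !mulgA.
    by rewrite h2 xE.
  by rewrite -[a * b]sinvK -/x (idem_sinv xx) xx.
move=> ee ff.
have eeA w : w * e * e = w * e by rewrite -mulgA ee.
have ffA w : w * f * f = w * f by rewrite -mulgA ff.
have h1 := idemM _ _ ee ff; have h2 := idemM _ _ ff ee.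
rewrite -[LHS](idem_sinv h1); apply/esym/sinv_uniq.
  by rewrite -[RHS]h1 !mulgA ffA eeA.
by rewrite -[RHS]h2 !mulgA eeA ffA.
Qed.

Lemma mulxV_idem x : x * x^-1 * (x * x^-1) = x * x^-1.
Proof. by rewrite mulgA mulgVg. Qed.

Lemma mulVx_idem x : x^-1 * x * (x^-1 * x) = x^-1 * x.
Proof. by rewrite mulgA mulVgV. Qed.

Lemma sinvM x y : (x * y)^-1 = y^-1 * x^-1.
Proof.
have c := idem_comm (mulVx_idem x) (mulxV_idem y).
apply/esym/sinv_uniq.
  have -> : x * y * (y^-1 * x^-1) * (x * y) =
      x * ((y * y^-1) * (x^-1 * x)) * y by rewrite !mulgA.
  by rewrite -c !mulgA mulgVg -!mulgA (mulgA y) mulgVg.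
have -> : y^-1 * x^-1 * (x * y) * (y^-1 * x^-1) =
    y^-1 * ((x^-1 * x) * (y * y^-1)) * x^-1 by rewrite !mulgA.
by rewrite c !mulgA mulVgV -!mulgA (mulgA x^-1) mulVgV.
Qed.

Lemma prec_mulV x y : prec x y -> x = y * (x^-1 * x).
Proof.
move=> h; have : (x * y^-1)^-1 = (x * x^-1)^-1 by rewrite h.
by rewrite !sinvM !sinvK mulgA => ->; rewrite mulgVg.
Qed.

Lemma mul_idem_prec e y : e * e = e -> prec (e * y) y.
Proof.
move=> ee; rewrite /prec sinvM (idem_sinv ee).
have -> : e * y * (y^-1 * e) = e * ((y * y^-1) * e) by rewrite !mulgA.
by rewrite -(idem_comm ee (mulxV_idem y)) !mulgA ee.
Qed.

Lemma precE x y : prec x y <-> x = x * x^-1 * y.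
Proof.
split=> [/prec_mulV h|->]; last by apply: mul_idem_prec; exact: mulxV_idem.
have := mulVx_idem x; move: (x^-1 * x) h => f -> ff.
rewrite sinvM (idem_sinv ff).
have -> : y * f * (f * y^-1) * y = y * ((f * f) * (y^-1 * y)).
  by rewrite !mulgA.
by rewrite ff (idem_comm ff (mulVx_idem y)) 2!mulgA mulgVg.
Qed.

Lemma precP x y : prec x y <-> exists2 e, e * e = e & x = e * y.
Proof.
split=> [/precE h|[e ee ->]]; last exact: mul_idem_prec.
by exists (x * x^-1) => //; exact: mulxV_idem.
Qed.

Lemma prec_refl x : prec x x.
Proof. by []. Qed.

Lemma prec_trans y x z : prec x y -> prec y z -> prec x z.
Proof.
move=> /precP[e ee ->] /precP[f ff ->]; apply/precP; exists (e * f).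
  have -> : e * f * (e * f) = e * (f * e) * f by rewrite !mulgA.
  by rewrite -(idem_comm ee ff) !mulgA ee -mulgA ff.
by rewrite mulgA.
Qed.

Lemma prec_anti x y : prec x y -> prec y x -> x = y.
Proof.
move=> /precE xE /precP[f ff yE].
have fx : y = f * y by rewrite {2}yE mulgA ff -yE.
rewrite xE yE !mulgA -(idem_comm ff (mulxV_idem x)) -mulgA mulgA.
by rewrite -(mulgA f) mulgVg.
Qed.

Lemma prec_sinv x y : prec x y -> prec x^-1 y^-1.
Proof.
move=> /prec_mulV ->; rewrite sinvM; apply/mul_idem_prec.
by rewrite (idem_sinv (mulVx_idem x)) mulVx_idem.
Qed.

Lemma prec_mul x y x' y' : prec x x' -> prec y y' -> prec (x * y) (x' * y').
Proof.
move=> /precE xE yy'; have /prec_mulV -> := yy'.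
have prec_mulr (a f : T) : f * f = f -> prec (a * f) a.
  move=> ff; rewrite -[a in prec _ a]sinvK -[a * f]sinvK; apply: prec_sinv.
  by rewrite sinvM (idem_sinv ff); exact: mul_idem_prec.
apply: (@prec_trans (x * y')).
  by rewrite mulgA; apply/prec_mulr/mulVx_idem.
by rewrite xE -mulgA; apply/mul_idem_prec/mulxV_idem.
Qed.

End InvSemigroupTheory.

Section DirectedSets.
Variable T : invSemigroupType.
Implicit Types A B C : set T.

Definition directed A : Prop :=
  A !=set0 /\
  forall a b, A a -> A b -> exists2 c, A c & prec c a /\ prec c b.

Definition set_prec A B : Prop :=
  forall b, B b -> exists2 a, A a & prec a b.

Definition set_equiv A B : Prop := set_prec A B /\ set_prec B A.

Definition mul_set A B : set T := [set a * b | a in A & b in B].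
Definition inv_set A : set T := [set a^-1 | a in A].

Lemma set_prec_refl A : set_prec A A.
Proof. by move=> a Aa; exists a. Qed.

Lemma set_prec_trans B A C : set_prec A B -> set_prec B C -> set_prec A C.
Proof.
move=> AB BC c /BC[b /AB[a Aa ab] bc]; exists a => //.
exact: prec_trans ab bc.
Qed.

Lemma set_equiv_refl A : set_equiv A A.
Proof. by split; exact: set_prec_refl. Qed.

Lemma set_equiv_sym A B : set_equiv A B -> set_equiv B A.
Proof. by case. Qed.

Lemma set_equiv_trans B A C :
  set_equiv A B -> set_equiv B C -> set_equiv A C.
Proof.
by move=> [AB BA] [BC CB]; split; [exact: set_prec_trans AB BC|
  exact: set_prec_trans CB BA].
Qed.

Lemma set_prec_mul A B A' B' :
  set_prec A A' -> set_prec B B' -> set_prec (mul_set A B) (mul_set A' B').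
Proof.
move=> AA BB _ [a /AA[a' Aa' aa] [b /BB[b' Bb' bb] <-]].
by exists (a' * b'); [exists a' => //; exists b'|exact: prec_mul].
Qed.

Lemma set_prec_inv A A' : set_prec A A' -> set_prec (inv_set A) (inv_set A').
Proof.
move=> AA _ [a /AA[a' Aa' aa] <-].
by exists a'^-1; [exists a'|exact: prec_sinv].
Qed.

Lemma directed1 x : directed [set x].
Proof. by split; [exists x|move=> a b -> ->; exists x]. Qed.

Lemma directed_mul A B : directed A -> directed B -> directed (mul_set A B).
Proof.
move=> [[a Aa] dA] [[b Bb] dB]; split.
  by exists (a * b); exists a => //; exists b.
move=> _ _ [a1 A1 [b1 B1 <-]] [a2 A2 [b2 B2 <-]].
have [c Ac [c1 c2]] := dA _ _ A1 A2; have [d Bd [d1 d2]] := dB _ _ B1 B2.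
exists (c * d); first by exists c => //; exists d.
by split; exact: prec_mul.
Qed.

Lemma directed_inv A : directed A -> directed (inv_set A).
Proof.
move=> [[a Aa] dA]; split; first by exists a^-1; exists a.
move=> _ _ [a1 A1 <-] [a2 A2 <-].
have [c Ac [c1 c2]] := dA _ _ A1 A2.
by exists c^-1; [exists c|split; exact: prec_sinv].
Qed.

Lemma mul_setA A B C :
  mul_set A (mul_set B C) = mul_set (mul_set A B) C.
Proof.
apply/seteqP; split=> x.
  move=> [a Aa [_ [b Bb [c Cc <-]] <-]].
  exists (a * b); first by exists a => //; exists b.
  by exists c => //; rewrite mulgA.
move=> [_ [a Aa [b Bb <-]] [c Cc <-]].
exists a => //; exists (b * c); last by rewrite mulgA.
by exists b => //; exists c.
Qed.

Lemma equiv_mulVg A : directed A ->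
  set_equiv (mul_set (mul_set A (inv_set A)) A) A.
Proof.
move=> [_ dA]; split.
  move=> a Aa; exists a => //; exists (a * a^-1); last first.
    by exists a => //; rewrite mulgVg.
  by exists a => //; exists a^-1 => //; exists a.
move=> _ [_ [a Aa [_ [b Bb <-] <-]] [c Cc <-]].
have [d Ad [da db]] := dA _ _ Aa Bb; have [e Ae [ed ec]] := dA _ _ Ad Cc.
exists e => //; rewrite -[e]mulgVg.
apply: prec_mul ec; apply: prec_mul; first exact: prec_trans ed da.
by apply: prec_sinv; exact: prec_trans ed db.
Qed.

Lemma equiv_mulVgV A : directed A ->
  set_equiv (mul_set (mul_set (inv_set A) A) (inv_set A)) (inv_set A).
Proof.
move=> dA; have := equiv_mulVg (directed_inv dA).
suff -> : inv_set (inv_set A) = A by [].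
apply/seteqP; split=> [_ [_ [a Aa <-] <-]|a Aa]; first by rewrite sinvK.
by exists a^-1; [exists a|rewrite sinvK].
Qed.

Lemma equiv_idem A : directed A -> set_equiv (mul_set A A) A ->
  forall a, A a -> exists e, [/\ A e, e * e = e & prec e a].
Proof.
move=> [_ dA] [h1 h2] a Aa.
have [_ [b Ab [c Ac <-]] bca] := h1 _ Aa.
have [d1 Ad1 [d1b d1c]] := dA _ _ Ab Ac.
have [d Ad [dd1 da]] := dA _ _ Ad1 Aa.
have [d2 Ad2 d2dd] := h2 (d * d) (ex_intro2 _ _ d Ad (ex_intro2 _ _ d Ad erefl)).
have [e Ae [ed2 ed]] := dA _ _ Ad2 Ad.
have edd : prec e (d * d) by exact: prec_trans ed2 d2dd.
have /precE eE := ed.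
have eed : e = e * d.
  by rewrite {1}((precE _ _).1 edd) mulgA -eE.
have gd : prec (e^-1 * e) d.
  apply/precE; rewrite (idem_sinv (mulVx_idem e)) mulVx_idem.
  by rewrite -mulgA -eed.
have eg : e = e^-1 * e.
  rewrite {1}(prec_mulV ed); have /precE := gd.
  have /prec_mulV := gd.
  by rewrite (idem_sinv (mulVx_idem e)) mulVx_idem => <-.
exists e; split=> //; last exact: prec_trans ed da.
by rewrite {1 2}eg mulVx_idem -eg.
Qed.

Lemma equiv_idem_comm A B : directed A -> directed B ->
  set_equiv (mul_set A A) A -> set_equiv (mul_set B B) B ->
  set_equiv (mul_set A B) (mul_set B A).
Proof.
have half (C D : set T) : directed C -> directed D ->
    set_equiv (mul_set C C) C -> set_equiv (mul_set D D) D ->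
    set_prec (mul_set C D) (mul_set D C).
  move=> dC dD hC hD _ [d Dd [c Cc <-]].
  have [e [Ce ee ec]] := equiv_idem dC hC Cc.
  have [f [Df ff fd]] := equiv_idem dD hD Dd.
  exists (e * f); first by exists e => //; exists f.
  by rewrite (idem_comm ee ff); exact: prec_mul.
by move=> dA dB hA hB; split; exact: half.
Qed.

(* O(T) as a quotient of the type of directed sets *)
Definition dirset := set_type [set A : set T | directed A].
HB.instance Definition _ := Choice.on dirset.

Definition Dir A (dA : directed A) : dirset := exist _ A (mem_set dA).

Lemma dirsetP (A : dirset) : directed (val A).
Proof. exact: set_valP. Qed.

Definition dirset_equiv (A B : dirset) : bool :=
  `[< set_equiv (val A) (val B) >].

Lemma dirset_equiv_refl : reflexive dirset_equiv.
Proof. by move=> A; apply/asboolP; exact: set_equiv_refl. Qed.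

Lemma dirset_equiv_sym : symmetric dirset_equiv.
Proof. by move=> A B; apply: asbool_equiv_eq; split; exact: set_equiv_sym. Qed.

Lemma dirset_equiv_trans : transitive dirset_equiv.
Proof.
move=> B A C /asboolP AB /asboolP BC; apply/asboolP.
exact: set_equiv_trans AB BC.
Qed.

Canonical dirset_equiv_rel :=
  EquivRel dirset_equiv dirset_equiv_refl dirset_equiv_sym dirset_equiv_trans.

Definition dirclass := {eq_quot dirset_equiv}.
HB.instance Definition _ := Choice.on dirclass.

(* [A] *)
Definition class A (dA : directed A) : dirclass := \pi_dirclass (Dir dA).

Lemma classP A B (dA : directed A) (dB : directed B) :
  class dA = class dB <-> set_equiv A B.
Proof.
split=> [/eqmodP/asboolP|h] //.
by apply/eqmodP/asboolP.
Qed.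

Lemma class_surj (X : dirclass) : exists A (dA : directed A), X = class dA.
Proof.
exists (val (repr X)), (dirsetP (repr X)).
rewrite -[LHS]reprK; congr (\pi_dirclass _).
exact: val_inj.
Qed.

Definition class_mul (X Y : dirclass) : dirclass :=
  class (directed_mul (dirsetP (repr X)) (dirsetP (repr Y))).

Definition class_inv (X : dirclass) : dirclass :=
  class (directed_inv (dirsetP (repr X))).

Lemma repr_class A (dA : directed A) : set_equiv (val (repr (class dA))) A.
Proof.
apply/(classP (dirsetP _) dA); rewrite -[RHS]reprK; congr (\pi_dirclass _).
exact: val_inj.
Qed.

Lemma class_mul_class A B (dA : directed A) (dB : directed B) :
  class_mul (class dA) (class dB) = class (directed_mul dA dB).
Proof.
have [hA hA'] := repr_class dA; have [hB hB'] := repr_class dB.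
by apply/classP; split; exact: set_prec_mul.
Qed.

Lemma class_inv_class A (dA : directed A) :
  class_inv (class dA) = class (directed_inv dA).
Proof.
have [hA hA'] := repr_class dA.
by apply/classP; split; exact: set_prec_inv.
Qed.

Lemma class_mulA : associative class_mul.
Proof.
move=> X Y Z; have [A [dA ->]] := class_surj X.
have [B [dB ->]] := class_surj Y; have [C [dC ->]] := class_surj Z.
rewrite !class_mul_class; apply/classP; rewrite mul_setA; exact: set_equiv_refl.
Qed.

HB.instance Definition _ := isSemigroup.Build dirclass class_mulA.

Lemma class_mulE A B (dA : directed A) (dB : directed B) :
  class dA * class dB = class (directed_mul dA dB).
Proof. exact: class_mul_class. Qed.

Lemma class_mulVg (X : dirclass) : X * class_inv X * X = X.
Proof.
have [A [dA ->]] := class_surj X.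
by rewrite class_inv_class !class_mulE; apply/classP; exact: equiv_mulVg.
Qed.

Lemma class_mulVgV (X : dirclass) :
  class_inv X * X * class_inv X = class_inv X.
Proof.
have [A [dA ->]] := class_surj X.
by rewrite class_inv_class !class_mulE; apply/classP; exact: equiv_mulVgV.
Qed.

Lemma class_idem_comm (X Y : dirclass) :
  X * X = X -> Y * Y = Y -> X * Y = Y * X.
Proof.
have [A [dA ->]] := class_surj X; have [B [dB ->]] := class_surj Y.
rewrite !class_mulE => /classP hA /classP hB.
by apply/classP; exact: equiv_idem_comm.
Qed.

Lemma class_inv_uniq (X Y : dirclass) :
  X * Y * X = X -> Y * X * Y = Y -> Y = class_inv X.
Proof.
move=> h1 h2; have h3 := class_mulVg X; have h4 := class_mulVgV X.
set Z := class_inv X in h3 h4 *.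
have YX : Y * X * (Y * X) = Y * X by rewrite mulgA h2.
have ZX : Z * X * (Z * X) = Z * X by rewrite mulgA h4.
have XY : X * Y * (X * Y) = X * Y by rewrite mulgA h1.
have XZ : X * Z * (X * Z) = X * Z by rewrite mulgA h3.
transitivity (Z * X * Y).
  have YE : (Y * X) * (Z * X) * Y = Y.
    have -> : (Y * X) * (Z * X) * Y = Y * (X * Z * X) * Y by rewrite !mulgA.
    by rewrite h3 h2.
  by rewrite -[LHS]YE (class_idem_comm YX ZX) -!mulgA (mulgA Y) h2.
have ZE : Z * ((X * Y) * (X * Z)) = Z.
  have -> : Z * ((X * Y) * (X * Z)) = Z * (X * Y * X) * Z by rewrite !mulgA.
  by rewrite h1 h4.
by rewrite -[RHS]ZE (class_idem_comm XY XZ) !mulgA h4.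
Qed.

HB.instance Definition _ :=
  Semigroup_isInverse.Build dirclass class_mulVg class_mulVgV class_inv_uniq.

Lemma class_invE A (dA : directed A) :
  (class dA)^-1 = class (directed_inv dA).
Proof. exact: class_inv_class. Qed.

End DirectedSets.

Section NaturalOrder.
Variable T : invSemigroupType.

Lemma prec_class (A B : set T) (dA : directed A) (dB : directed B) :
  prec (class dA) (class dB) <-> set_prec A B.
Proof.
split=> [/precE|h].
  rewrite class_invE (class_mulE dA) class_mulE => /classP[h _] b Bb.
  have [[a Aa] _] := dA.
  have [|c Ac cab] := h (a * a^-1 * b).
    by exists (a * a^-1) => //; [exists a => //; exists a^-1 => //; exists a
      |exists b].
  exists c => //; apply: prec_trans cab _.
  by apply: mul_idem_prec; exact: mulxV_idem.
apply/precE; rewrite class_invE (class_mulE dA) class_mulE; apply/classP.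
have [[b0 Bb0] _] := dB; have [_ fA] := dA; split.
  move=> _ [_ [a1 A1 [_ [a2 A2 <-] <-]] [b Bb <-]].
  have [c Ac [c1 c2]] := fA _ _ A1 A2; have [d Ad db] := h _ Bb.
  have [e Ae [ec ed]] := fA _ _ Ac Ad; exists e => //.
  rewrite -[e]mulgVg; apply: prec_mul; last exact: prec_trans ed db.
  apply: prec_mul; first exact: prec_trans ec c1.
  by apply: prec_sinv; exact: prec_trans ec c2.
move=> a Aa; have [d Ad db] := h _ Bb0.
have [e Ae [ed ea]] := fA _ _ Ad Aa; exists (e * e^-1 * b0).
  by exists (e * e^-1); [exists e => //; exists e^-1 => //; exists e|exists b0].
by have /precE <- := prec_trans ed db.
Qed.

(* the inclusion x |-> [{x}] of T in dirclass T *)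
Definition embed (x : T) : dirclass T := class (directed1 x).

Lemma prec_embed (A : set T) (dA : directed A) x :
  prec (class dA) (embed x) <-> exists2 a, A a & prec a x.
Proof.
rewrite prec_class; split=> [/(_ x erefl)//|[a Aa ax] _ ->].
by exists a.
Qed.

Lemma embed_prec x y : prec x y -> prec (embed x) (embed y).
Proof. by move=> xy; apply/prec_embed; exists x. Qed.

End NaturalOrder.

(* gmul x y is meaningful only when gcomp x y holds *)
HB.mixin Record isGroupoid G := {
  gcomp : G -> G -> Prop;
  gmul : G -> G -> G;
  ginv : G -> G;
  ginvK : involutive ginv;
  gmulA : forall x y z, gcomp x y -> gcomp y z ->
    [/\ gcomp (gmul x y) z, gcomp x (gmul y z) &
        gmul x (gmul y z) = gmul (gmul x y) z];
  gcompV : forall x, gcomp (ginv x) x;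
  gmulKV : forall x y, gcomp x y -> gmul (ginv x) (gmul x y) = y;
  gmulVK : forall x y, gcomp x y -> gmul (gmul x y) (ginv y) = x
}.

#[short(type="groupoidType")]
HB.structure Definition Groupoid := {G of isGroupoid G}.

(* No continuity is required: the notions below only use the underlying       *)
(* groupoid and the underlying space.                                         *)
#[short(type="groupoidSpaceType")]
HB.structure Definition GroupoidSpace := {G of isGroupoid G & Topological G}.

Section Subgroupoids.
Variables (G : groupoidSpaceType) (H : set G).

Definition subgroupoid : Prop :=
  (forall x, H x -> H (ginv x)) /\
  forall x y, H x -> H y -> gcomp x y -> H (gmul x y).

Definition unit_space : set G := [set gmul x (ginv x) | x in H].

Definition orbit (p : G) : set G :=
  [set gmul x (ginv x) | x in [set x | H x /\ gmul (ginv x) x = p]].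

(* The type set_type A carries the subspace topology of A.                    *)
Definition minimal_groupoid : Prop :=
  forall p, unit_space p ->
  dense [set q : set_type unit_space | orbit p (val q)].

End Subgroupoids.

Section UniversalGroupoid.
Variable T : invSemigroupType.

Definition Gu : Type := dirclass T.
HB.instance Definition _ := Choice.on Gu.

Definition Gu_comp (X Y : dirclass T) : Prop := X^-1 * X = Y * Y^-1.

Lemma Gu_mulA (X Y Z : dirclass T) : Gu_comp X Y -> Gu_comp Y Z ->
  [/\ Gu_comp (X * Y) Z, Gu_comp X (Y * Z) & X * (Y * Z) = X * Y * Z].
Proof.
move=> XY YZ; split; last exact: mulgA; rewrite /Gu_comp sinvM -mulgA.
  by rewrite (mulgA X^-1) XY (mulgA Y^-1) (mulgA Y^-1) mulVgV.
by rewrite (mulgA Z) -YZ !mulgA mulgVg.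
Qed.

Lemma Gu_compV (X : dirclass T) : Gu_comp X^-1 X.
Proof. by rewrite /Gu_comp sinvK. Qed.

Lemma Gu_mulKV (X Y : dirclass T) : Gu_comp X Y -> X^-1 * (X * Y) = Y.
Proof. by move=> XY; rewrite mulgA XY mulgVg. Qed.

Lemma Gu_mulVK (X Y : dirclass T) : Gu_comp X Y -> X * Y * Y^-1 = X.
Proof. by move=> XY; rewrite -mulgA -XY mulgA mulgVg. Qed.

HB.instance Definition _ :=
  isGroupoid.Build Gu (@sinvK (dirclass T)) Gu_mulA Gu_compV Gu_mulKV Gu_mulVK.

(* U_x *)
Definition Gu_cone (x : T) : set Gu := [set X | prec (X : dirclass T) (embed x)].

Definition Gu_base : set (set Gu) :=
  [set U | exists (x : T) (n : nat) (xs : 'I_n -> T),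
    (forall i, prec (xs i) x) /\
    U = Gu_cone x `&` \bigcap_i ~` Gu_cone (xs i)].

Lemma Gu_coneI (x y z : T) : prec x z -> prec y z ->
  Gu_cone x `&` Gu_cone y = Gu_cone (x * x^-1 * y).
Proof.
have mem (w : T) (X : Gu) (A : set T) (dA : directed A) : X = class dA ->
    Gu_cone w X <-> exists2 a, A a & prec a w.
  by move=> ->; exact: prec_embed.
move=> xz yz; apply/seteqP; split=> X;
    have [A [dA XA]] := class_surj X.
  move=> [] /(mem _ _ _ _ XA)[a Aa ax] /(mem _ _ _ _ XA)[b Ab b_y].
  have [_ fA] := dA; have [c Ac [ca cb]] := fA _ _ Aa Ab.
  apply/(mem _ _ _ _ XA); exists c => //.
  rewrite -[c]mulgVg; apply: prec_mul; last exact: prec_trans cb b_y.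
  by apply: prec_mul; [|apply: prec_sinv]; exact: prec_trans ca ax.
move=> /(mem _ _ _ _ XA)[a Aa ah].
split; apply/(mem _ _ _ _ XA); exists a => //; apply: (prec_trans ah).
  by have := prec_mul (prec_refl (x * x^-1)) yz; rewrite -((precE x z).1 xz).
by apply: mul_idem_prec; exact: mulxV_idem.
Qed.

Lemma Gu_cone_le (x y : T) : prec x y -> Gu_cone x `<=` Gu_cone y.
Proof. by move=> xy X Xx; apply: prec_trans Xx _; exact: embed_prec. Qed.

Lemma Gu_base_cover : \bigcup_(U in Gu_base) U = setT.
Proof.
apply/seteqP; split=> // X _; have [A [dA XA]] := class_surj X.
have [[a Aa] _] := dA; exists (Gu_cone a); last first.
  by rewrite /Gu_cone/= XA; apply/prec_embed; exists a.
exists a, 0%N, (fun=> a); split; first by case.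
by apply/seteqP; split=> [Y Ya|Y []//]; split=> // -[].
Qed.

Lemma Gu_base_join (U V : set Gu) (X : Gu) :
  Gu_base U -> Gu_base V -> U X -> V X ->
  exists W, [/\ Gu_base W, W X & W `<=` U `&` V].
Proof.
move=> [x [m [xs [xsx ->]]]] [y [n [ys [ysy ->]]]] [Xx Xxs] [Xy Xys].
have [A [dA XA]] := class_surj X; have [_ fA] := dA.
have [a Aa ax] : exists2 a, A a & prec a x.
  by apply/(prec_embed dA); rewrite -XA.
have [b Ab b_y] : exists2 b, A b & prec b y.
  by apply/(prec_embed dA); rewrite -XA.
have [c Ac [ca cb]] := fA _ _ Aa Ab.
have cx := prec_trans ca ax; have cy := prec_trans cb b_y.
have Xc : Gu_cone c X by rewrite /Gu_cone/= XA; apply/prec_embed; exists c.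
pose zs (i : 'I_(m + n)) :=
  match fintype.split i with inl j => xs j | inr j => ys j end.
pose ws i := zs i * (zs i)^-1 * c.
have wsE i : Gu_cone (zs i) `&` Gu_cone c = Gu_cone (ws i).
  by rewrite /ws /zs; case: (fintype.split i) => j; exact: Gu_coneI.
exists (Gu_cone c `&` \bigcap_i ~` Gu_cone (ws i)); split.
- exists c, (m + n)%N, ws; split=> // i.
  by apply: mul_idem_prec; exact: mulxV_idem.
- split=> // i _; rewrite -wsE /zs => -[]; case: (fintype.split i) => j Xj _.
    exact: Xxs Xj.
  exact: Xys Xj.
- move=> Y [Yc Yws]; split.
    split; first exact: Gu_cone_le Yc.
    move=> i _ Yi; apply: (Yws (unsplit (inl i))) => //.
    by rewrite -wsE /zs unsplitK.
  split; first exact: Gu_cone_le Yc.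
  move=> i _ Yi; apply: (Yws (unsplit (inr i))) => //.
  by rewrite -wsE /zs unsplitK.
Qed.

HB.instance Definition _ :=
  isBaseTopological.Build Gu Gu_base_cover Gu_base_join.

Lemma Gu_openE :
  @open Gu = [set \bigcup_(U in D) U | D in subset^~ Gu_base].
Proof. by []. Qed.

Definition Gm : set Gu := [set X | minimal_elt (X : dirclass T)].

End UniversalGroupoid.

Section MinimalGroupoid.
Variable T : invSemigroupType.
Implicit Types x y z : T.

Lemma prec_mulKV x y : prec (x * (x^-1 * y)) y.
Proof. by rewrite mulgA; apply/mul_idem_prec/mulxV_idem. Qed.

Lemma is_zeroMl x z : is_zero z -> is_zero (x * z).
Proof.
move=> z0 y; apply: prec_trans (prec_mulKV x y).
exact: prec_mul (prec_refl x) (z0 _).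
Qed.

Lemma is_zeroV z : is_zero z -> is_zero z^-1.
Proof. by move=> z0 y; rewrite -[y]sinvK; apply: prec_sinv. Qed.

Lemma minimal_eltV x : minimal_elt x -> minimal_elt x^-1.
Proof.
move=> [x0 xmin]; split=> [/is_zeroV|y yx y0]; first by rewrite sinvK.
apply: (can_inj (@sinvK T)); rewrite sinvK; apply: xmin.
  by rewrite -[x]sinvK; exact: prec_sinv.
by move=> /is_zeroV; rewrite sinvK.
Qed.

Lemma minimal_eltM x y :
  x^-1 * x = y * y^-1 -> minimal_elt x -> minimal_elt y -> minimal_elt (x * y).
Proof.
move=> xy [x0 xmin] [y0 ymin].
have xxy : x^-1 * (x * y) = y by rewrite mulgA xy mulgVg.
split=> [/(is_zeroMl x^-1)|z zxy z0]; first by rewrite xxy.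
have zE : x * (x^-1 * z) = z.
  by rewrite (prec_mulV zxy) !mulgA mulgVg.
have xzy : prec (x^-1 * z) y.
  by rewrite -[in prec _ y]xxy; exact: prec_mul (prec_refl _) zxy.
rewrite -zE (ymin _ xzy) // => /(is_zeroMl x).
by rewrite zE.
Qed.

End MinimalGroupoid.

Lemma Gm_subgroupoid (T : invSemigroupType) : subgroupoid (@Gm T).
Proof.
split=> [X X0|X Y X0 Y0 XY].
  exact: (@minimal_eltV (dirclass T)).
exact: (@minimal_eltM (dirclass T)).
Qed.

Definition LC (T : invSemigroupType) : Prop :=
  [/\ exists z : T, is_zero z,
      forall x y : T,
        (exists w, [/\ prec w x, prec w y & nonzero w]) ->
        exists z, largest_common_precessor x y z &
      closed [set p : set_type (unit_space [set: Gu T]) |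
                unit_space (@Gm T) (val p)]].

(* Main.v *)
(* (i) <-> (ii): for fixed p, the q admitting a family as in (ii) form the
   smallest <-closed invariant set containing p.

   (ii) -> (iii): by (LC) a minimal class not below x contains an element with
   no nonzero common precessor with x.  Hence a basic neighbourhood of a minimal
   unit contains all minimal units below some idempotent q <> 0, and the family
   obtained by covering an element of P from q contains an x such that x^-1 P
   moves P below q.

   (iii) -> (ii): if no finite family covers q from p, then the minimal units
   below q that avoid all the x x^-1 with x^-1 x below p have the finite
   intersection property.  The units of G_m below q form a compact set because
   G_m^(0) is closed, so a single minimal unit P avoids all these x x^-1, and
   its orbit misses the nonempty open set of minimal units below p. *)

Require Import Defs.
From mathcomp Require Import all_boot all_classical topology.

Local Open Scope group_scope.
Local Open Scope classical_set_scope.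

Local Notation "x ^-1" := (sinv x) : group_scope.

(** * Idempotents, conjugation, and the equivalence of (i) and (ii) *)

Section InverseSemigroup.
Context {T : invSemigroupType}.
Implicit Types x y z p q e f : T.

Lemma prec_is_zero x y : prec x y -> is_zero y -> is_zero x.
Proof. by move=> xy y0 z; apply: prec_trans xy (y0 z). Qed.

Lemma prec_nonzero x y : prec x y -> nonzero x -> nonzero y.
Proof. by move=> xy x0 y0; apply: x0; apply: prec_is_zero xy y0. Qed.

Lemma is_zero_uniq x y : is_zero x -> is_zero y -> x = y.
Proof. by move=> x0 y0; apply: prec_anti. Qed.

Lemma is_zeroMr x z : is_zero z -> is_zero (z * x).
Proof.
move=> z0; rewrite -[z * x]sinvK sinvM.
by apply/is_zeroV/is_zeroMl/is_zeroV.
Qed.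

Lemma prec_idem x e : e * e = e -> prec x e -> x * x = x.
Proof.
move=> ee /precP[f ff ->].
by rewrite mulgA -(mulgA f e f) (idem_comm ee ff) mulgA ff -mulgA ee.
Qed.

Lemma idemM e f : e * e = e -> f * f = f -> e * f * (e * f) = e * f.
Proof. by move=> ee ff; apply: prec_idem ff _; apply: mul_idem_prec. Qed.

Lemma prec_idem_mul z e f : e * e = e ->
  prec z e -> prec z f -> prec z (e * f).
Proof. by move=> ee ze zf; rewrite -(prec_idem _ _ ee ze); apply: prec_mul. Qed.

Lemma prec_idem_mull z e f : e * e = e -> f * f = f ->
  prec z (e * f) -> prec z e.
Proof.
move=> ee ff zef; apply: prec_trans zef _.
by rewrite (idem_comm ee ff); apply: mul_idem_prec.
Qed.

Lemma conj_prec x y z : prec y z -> prec (x * y * x^-1) (x * z * x^-1).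
Proof. by move=> yz; apply: prec_mul => //; apply: prec_mul. Qed.

Lemma conj_idem x e : e * e = e -> x * e * x^-1 * (x * e * x^-1) = x * e * x^-1.
Proof.
move=> ee; have -> : x * e * x^-1 * (x * e * x^-1) =
  x * (e * (x^-1 * x)) * e * x^-1 by rewrite !mulgA.
by rewrite (idem_comm ee (mulVx_idem x)) !mulgA mulgVg -(mulgA x) ee.
Qed.

Lemma idem_mul_precE p q : p * p = p -> prec q p -> p * q = q.
Proof.
move=> pp qp; have qq := prec_idem _ _ pp qp.
move/precE: qp; rewrite (idem_sinv qq) qq => {2}->.
by rewrite (idem_comm qq pp).
Qed.

(** The idempotent [x^-1 * x] acts as an identity on the idempotents below it. Conjugation by [x] is
    thus reversible on them and cannot produce zero from a nonzero one. *)
Lemma conjK x p : p * p = p -> prec p (x^-1 * x) ->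
  x^-1 * (x * p * x^-1) * x = p.
Proof.
move=> pp px; have xp := idem_mul_precE _ _ (mulVx_idem x) px.
have -> : x^-1 * (x * p * x^-1) * x = x^-1 * x * p * (x^-1 * x).
  by rewrite !mulgA.
by rewrite xp -(idem_comm (mulVx_idem x) pp).
Qed.

Lemma nonzero_conj x p : p * p = p -> prec p (x^-1 * x) -> nonzero p ->
  nonzero (x * p * x^-1).
Proof.
move=> pp px p0 c0; apply: p0; rewrite -(conjK x p) //.
by apply/is_zeroMr/is_zeroMl.
Qed.

(* The conclusion of condition (ii), with a possibly empty list (padded with p
   in [spannedP]) in place of the nonempty tuple, so that families can be
   concatenated. *)
Definition spanned p q : Prop := exists s : seq T,
  (forall x, x \in s -> prec (x^-1 * x) p) /\
  forall y, prec y q -> nonzero y ->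
  exists z, nonzero z /\ exists2 x, x \in s & prec z y /\ prec z (x * x^-1).

Lemma spannedP p q : p * p = p -> spanned p q <->
  exists n (x : 'I_n.+1 -> T),
    (forall j, prec ((x j)^-1 * x j) p) /\ covered q (fun j => x j * (x j)^-1).
Proof.
move=> pp; split=> [[s [sp sq]]|[n [f [fp fq]]]]; last first.
  exists (codom f); split=> [_ /codomP[j ->]//|y yq y0].
  have [z [z0 [j [zy zj]]]] := fq _ yq y0.
  by exists z; split=> //; exists (f j) => //; apply: codom_f.
exists (size s), (fun j => nth p (p :: s) j); split=> [j|y yq y0].
  have : nth p (p :: s) j \in p :: s by apply: mem_nth.
  by rewrite inE => /orP[/eqP ->|/sp//]; rewrite (idem_sinv pp) pp.
have [z [z0 [x xs [zy zx]]]] := sq _ yq y0; exists z; split=> //.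
(* The padding [p] takes index 0, which shifts [s] by one. *)
have xs' : (index x s).+1 < (size s).+1 by rewrite ltnS index_mem.
by exists (Ordinal xs'); rewrite /= nth_index.
Qed.

Lemma spanned_refl p : p * p = p -> spanned p p.
Proof.
move=> pp; exists [:: p]; split=> [x|y yp y0].
  by rewrite inE => /eqP ->; rewrite (idem_sinv pp) pp.
exists y; split=> //; exists p; first by rewrite inE.
by rewrite (idem_sinv pp) pp.
Qed.

Lemma spanned_covered p q n (qs : 'I_n.+1 -> T) :
  (forall j, spanned p (qs j)) -> covered q qs -> spanned p q.
Proof.
move=> /choice[f fP] qqs.
exists (flatten [seq f i | i <- enum 'I_n.+1]); split=> [x|y yq y0].
  by move=> /flatten_mapP[i _ xi]; have [+ _] := fP i; apply.
have [z [z0 [i [zy zi]]]] := qqs _ yq y0.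
have [_ /(_ _ zi z0)[w [w0 [x xi [wz wx]]]]] := fP i.
exists w; split=> //; exists x.
  by apply/flatten_mapP; exists i; rewrite ?mem_enum.
by split=> //; apply: prec_trans wz zy.
Qed.

(** Each member of the family is multiplied by [x] on the left. A test element is carried below [q]
    by conjugation with [x^-1], and the precessor found there is carried back. *)
Lemma spanned_conj p q x : q * q = q -> prec q (x^-1 * x) ->
  spanned p q -> spanned p (x * q * x^-1).
Proof.
move=> qq qx [s [sp sq]]; exists [seq x * t | t <- s].
split=> [_ /mapP[t /sp ts ->]|y yq y0].
  apply: prec_trans ts; rewrite sinvM.
  have -> : t^-1 * x^-1 * (x * t) = t^-1 * (x^-1 * x * t) by rewrite !mulgA.
  by apply: prec_mul => //; apply/mul_idem_prec/mulVx_idem.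
have yy := prec_idem _ _ (conj_idem x _ qq) yq.
have yx : prec y (x^-1^-1 * x^-1).
  rewrite sinvK; apply: prec_trans yq _.
  by have := conj_prec x _ _ qx; rewrite !mulgA mulgVg.
have [] := sq (x^-1 * y * x^-1^-1).
- by have := conj_prec x^-1 _ _ yq; rewrite !sinvK conjK.
- exact: nonzero_conj.
move=> z [z0 [t ts [zy zt]]].
have zx : prec z (x^-1 * x).
  apply: prec_trans zy _; rewrite sinvK.
  have := conj_prec x^-1 _ _ yq; rewrite sinvK conjK // => h.
  exact: prec_trans h qx.
have zz : z * z = z by apply: prec_idem zt; apply: mulxV_idem.
exists (x * z * x^-1); split; first exact: nonzero_conj.
exists (x * t); first exact: map_f.
split; last by rewrite sinvM; have := conj_prec x _ _ zt; rewrite !mulgA.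
have := conj_prec x _ _ zy.
have := conjK x^-1 _ yy yx; rewrite sinvK => ->.
by [].
Qed.

Lemma closed_invariant_trivialP :
  (forall I : set T,
    I `<=` @idempotents T -> I !=set0 -> covered_closed I -> invariant_set I ->
    I = [set z | is_zero z] \/ I = @idempotents T) <->
  forall p q, p * p = p -> q * q = q -> nonzero p -> spanned p q.
Proof.
split=> [h p q pp qq p0|h I Iid [p0 Ip0] Icl Iinv].
  (* The idempotents spanned by [p] form a closed invariant set containing the nonzero [p], so this
     set must be everything. *)
  have [|||||] := h [set q | q * q = q /\ spanned p q].
  - by move=> x [].
  - by exists p; split=> //; apply: spanned_refl.
  - move=> r rr n rs rsP rc; split=> //.
    by apply: spanned_covered rc => j; have [] := rsP j.
  - move=> r x [rr pr] rx; split; first exact: conj_idem.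
    exact: spanned_conj.
  - move/seteqP => [/(_ p) + _] => /(_ (conj pp (spanned_refl _ pp))) /= z.
    by case: (p0 z).
  - by move/seteqP => [_ /(_ q qq)[]].
have [[p [Ip pn]]|I0] := pselect (exists p, I p /\ nonzero p); last first.
  have I0' p : I p -> is_zero p.
    by move=> Ip; apply: contrapT => pn; apply: I0; exists p.
  left; apply/seteqP; split=> z /= z0; first exact: I0'.
  by rewrite (is_zero_uniq _ _ z0 (I0' _ Ip0)).
right; apply/seteqP; split=> // q qq.
have pp := Iid _ Ip.
have [n [f [fp fq]]] := (spannedP _ q pp).1 (h _ _ pp qq pn).
apply: (Icl _ qq _ _ _ fq) => j.
(* Being below [p], this idempotent is covered by the one-element family [p]; conjugating it by
   [f j] then puts [f j * (f j)^-1] in [I]. *)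
have If : I ((f j)^-1 * f j).
  apply: (Icl _ (mulVx_idem _) 0%N (fun=> p)) => // y yf y0.
  by exists y; split=> //; exists ord0; split=> //; apply: prec_trans yf _.
have := Iinv _ (f j) If (prec_refl _).
by rewrite !mulgA mulgVg.
Qed.

End InverseSemigroup.

(** * Minimal classes of directed sets *)

Section Classes.
Context {T : invSemigroupType}.
Implicit Types (x y z e f : T) (A B : set T) (X Y P Q : dirclass T).

Lemma embedM x y : embed (x * y) = embed x * embed y.
Proof.
rewrite [in RHS]class_mulE; apply/classP.
have -> : mul_set [set x] [set y] = [set x * y].
  apply/seteqP; split=> [_ [_ -> [_ -> <-]]//|_ ->].
  by exists x => //; exists y.
exact: set_equiv_refl.
Qed.

Lemma embedV x : embed x^-1 = (embed x)^-1.
Proof.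
apply: sinv_uniq; rewrite -!embedM ?mulgVg //; by rewrite mulVgV.
Qed.

Lemma is_zero_class A (dA : directed A) : (exists z : T, is_zero z) ->
  is_zero (class dA) <-> exists2 a, A a & is_zero a.
Proof.
move=> [z z0]; split=> [/(_ (embed z))/prec_embed[a Aa az]|[a Aa a0] Y].
  by exists a => //; apply: prec_is_zero az z0.
have [B [dB ->]] := class_surj Y; apply/prec_class => b _.
by exists a.
Qed.

Lemma directed_lower_bound A (I : finType) (P : I -> T -> Prop) :
  directed A -> (forall i a b, prec a b -> P i b -> P i a) ->
  (forall i, exists2 a, A a & P i a) -> exists2 a, A a & forall i, P i a.
Proof.
move=> [[a0 Aa0] dA] Pdown PA.
suff [a Aa aP] : exists2 a, A a & forall i, i \in enum I -> P i a.
  by exists a => // i; apply: aP; rewrite mem_enum.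
elim: (enum I) => [|i s [a Aa aP]]; first by exists a0.
have [b Ab bP] := PA i; have [c Ac [ca cb]] := dA _ _ Aa Ab.
exists c => // j; rewrite inE => /orP[/eqP ->|/aP ja]; first exact: Pdown bP.
exact: Pdown ja.
Qed.

Lemma class_idem_sub A (dA : directed A) :
  class dA * class dA = class dA ->
  forall a, A a -> exists e, [/\ A e, e * e = e & prec e a].
Proof. by rewrite class_mulE => /classP h a; apply: equiv_idem. Qed.

(* Zorn's lemma applied to sets A, not containing zeros, such that A together
   with x is directed; the empty chain is thereby harmless. *)
Lemma minimal_below x : (exists z : T, is_zero z) -> nonzero x ->
  exists2 X, minimal_elt X & prec X (embed x).
Proof.
move=> Z x0.
pose D A := directed (x |` A) /\ forall a, A a -> nonzero a.
have [F FD Ftot|A [[dA A0] Amax]] := @Zorn_bigcup T D.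
  split; last by move=> a [A FA Aa]; have [_] := FD _ FA; apply.
  have lift A b : F A -> (x |` A) b -> (x |` \bigcup_(X in F) X) b.
    by move=> FA [->|Ab]; [left|right; exists A].
  split=> [|u v]; first by exists x; left.
  have both A a b : F A -> (x |` A) a -> (x |` A) b ->
      exists2 c, (x |` \bigcup_(X in F) X) c & prec c a /\ prec c b.
    move=> FA Aa Ab; have [[_ /(_ _ _ Aa Ab)[c Ac cab]] _] := FD _ FA.
    by exists c => //; apply: lift Ac.
  move=> [->|[A FA Aa]] [->|[B FB Bb]].
  - by exists x; [left|].
  - by apply: (both B) => //; [left|right].
  - by apply: (both A) => //; [right|left].
  - have [AB|BA] := Ftot _ _ FA FB.
      by apply: (both B) => //; right => //; apply: AB.
    by apply: (both A) => //; right => //; apply: BA.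
have A0' a : (x |` A) a -> nonzero a by move=> [->//|/A0].
exists (class dA); last by apply/prec_embed; exists x => //; left.
split=> [/(is_zero_class _ _ Z)[a /A0' a0 /a0]//|Y].
have [B [dB ->]] := class_surj Y => /prec_class BA Bn.
have B0 b : B b -> nonzero b.
  by move=> Bb b0; apply: Bn; apply/is_zero_class => //; exists b.
(* The upward closure [C] of [B] contains [x] and [A], so maximality of [A] forces [C], and with it
   [B], into [A]. *)
pose C := [set c | exists2 b, B b & prec b c].
have CA : x |` A `<=` C by move=> a /BA.
have Cx : x |` C = C.
  by apply/seteqP; split=> [c [->|//]|c Cc]; [apply: CA; left|right].
have DC : D C.
  split; last by move=> c [b /B0 b0 bc]; apply: prec_nonzero bc b0.
  rewrite Cx; split; first by exists x; apply: CA; left.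
  move=> c d [b Bb bc] [b' Bb' bd].
  have [_ /(_ _ _ Bb Bb')[e Be [eb eb']]] := dB.
  exists e; first by exists e.
  by split; [apply: prec_trans eb bc|apply: prec_trans eb' bd].
have CsubA : C `<=` A.
  apply: contrapT => CA'; apply: (Amax C) => //.
  by split=> [|//]; apply: subset_trans CA => a Aa; right.
apply: prec_anti; first exact/prec_class.
by apply/prec_class => b Bb; exists b => //; right; apply: CsubA; exists b.
Qed.

Context (hT : LC T).

(** When zero is the only common precessor, it is also the largest. *)
Lemma LC_meet x y : exists z, largest_common_precessor x y z.
Proof.
have [[z z0] h _] := hT.
have [/h//|n] := pselect (exists w, [/\ prec w x, prec w y & nonzero w]).
exists z; split=> // w wx wy.
by have w0 : is_zero w by apply: contrapT => w0; apply: n; exists w.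
Qed.

(** Otherwise the largest common precessors [m a] of [x] and the [a] in [A] are all nonzero. They
    form a directed set with a nonzero class below both [class dA] and [embed x], and minimality
    identifies it with [class dA]. *)
Lemma minimal_disjoint A (dA : directed A) x :
  minimal_elt (class dA) -> ~ prec (class dA) (embed x) ->
  exists2 a, A a & forall z, prec z a -> prec z x -> is_zero z.
Proof.
have [Z _ _] := hT => -[_ Amin] nAx.
have [m mP] := choice (LC_meet x).
apply: contrapT => nA; apply: nAx.
have m0 a : A a -> nonzero (m a).
  move=> Aa ma0; apply: nA; exists a => // z za zx.
  by apply: prec_is_zero ma0; have [_ _] := mP a; apply.
pose B := [set m a | a in A].
have dB : directed B.
  have [[a Aa] fA] := dA; split; first by exists (m a); exists a.
  move=> _ _ [b Ab <-] [c Ac <-]; have [d Ad [db dc]] := fA _ _ Ab Ac.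
  exists (m d); first by exists d.
  have [dx dd _] := mP d.
  split; [have [_ _] := mP b|have [_ _] := mP c]; apply=> //.
    exact: prec_trans dd db.
  exact: prec_trans dd dc.
have -> : class dA = class dB.
  apply/esym/Amin.
    by apply/prec_class => a Aa; exists (m a); [exists a|have [] := mP a].
  by move=> /(is_zero_class _ _ Z)[_ [a Aa <-]]; apply: m0.
apply/prec_embed; have [[a Aa] _] := dA; exists (m a); first by exists a.
by have [] := mP a.
Qed.

End Classes.

(** * Units, orbits and topology of [Gm T] *)

Section Minimality.
Context {T : invSemigroupType}.
Implicit Types (x y z p q : T) (X Y P Q R : dirclass T).

(** Any [Y] below [X] equals [X * (Y^-1 * Y)], so it is determined by an idempotent below the
    minimal [X^-1 * X]. *)
Lemma minimal_idem_source X :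
  minimal_elt (X^-1 * X) -> minimal_elt X.
Proof.
move=> [s0 smin]; split=> [X0|Y YX Y0]; first exact/s0/is_zeroMl.
have YE := prec_mulV YX.
suff YY : Y^-1 * Y = X^-1 * X by rewrite YE YY mulgA mulgVg.
apply: smin; first by apply: prec_mul => //; apply: prec_sinv.
by move=> /(is_zeroMl X); rewrite -YE.
Qed.

Lemma unit_GmP P : unit_space (@Gm T) P <-> minimal_elt P /\ P * P = P.
Proof.
split=> [[X Xm <-]|[Pm PP]].
  split; last exact: mulxV_idem.
  by apply: minimal_eltM => //; [rewrite sinvK|apply: minimal_eltV].
by exists (P : Gu T) => //; rewrite -[RHS]PP -{4}(idem_sinv PP).
Qed.

Lemma unit_GuP P : P * P = P -> unit_space [set: Gu T] P.
Proof.
by move=> PP; exists (P : Gu T) => //; rewrite -[RHS]PP -{4}(idem_sinv PP).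
Qed.

Lemma orbit_GmP P R : minimal_elt P ->
  Defs.orbit (@Gm T) P R <-> exists2 X, X^-1 * X = P & R = X * X^-1.
Proof.
move=> Pm; split=> [[X [_ XP] <-]|[X XP ->]]; first by exists X.
by exists (X : Gu T) => //; split=> //; apply: minimal_idem_source; rewrite XP.
Qed.

Lemma Gu_base_open (W : set (Gu T)) : Gu_base W -> open W.
Proof.
move=> bW; rewrite Gu_openE; exists [set W]; first by move=> _ ->.
by apply/seteqP; split=> [X [_ ->]//|X WX]; exists W.
Qed.

(** Open sets of the unit subspace are traces of unions of basic sets, so density can be tested on a
    single basic set around a minimal unit. *)
Lemma Gm_minimalP : minimal_groupoid (@Gm T) <->
  forall P Q, unit_space (@Gm T) P -> unit_space (@Gm T) Q ->
  forall W : set (Gu T), Gu_base W -> W Q ->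
  exists2 R, Defs.orbit (@Gm T) P R & W R.
Proof.
split=> [h P Q PU QU W bW WQ|h P PU O [Q OQ] [V oV VO]].
  have [|//|R [/= WR PR]] := h P PU (set_val @^-1` W).
  - by exists (exist _ (Q : Gu T) (mem_set QU)).
  - by exists W => //; apply: Gu_base_open.
  by exists (set_val R).
move: OQ oV; rewrite -VO Gu_openE => VQ [D DB DV].
move: VQ; rewrite -DV => -[W DW WQ].
have [R PR WR] := h P (set_val Q) PU (set_valP Q) W (DB _ DW) WQ.
have RU : unit_space (@Gm T) R by have [X [XG _] <-] := PR; exists X.
exists (exist _ (R : Gu T) (mem_set RU)); split; last exact: PR.
by exists W.
Qed.

Lemma LC_closed : LC T -> forall Q, Q * Q = Q ->
  (forall W : set (Gu T), Gu_base W -> W Q ->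
     exists2 P, unit_space (@Gm T) P & W P) -> unit_space (@Gm T) Q.
Proof.
move=> [_ _ clG] Q QQ h.
apply: (clG (exist _ (Q : Gu T) (mem_set (unit_GuP _ QQ)))).
move=> N; rewrite nbhsE => -[_ [[V oV <-]] VQ VN].
move: oV; rewrite Gu_openE => -[D DB DV].
move: VQ; rewrite -DV => -[W DW WQ].
have [P PG WP] := h W (DB _ DW) WQ.
have [_ PP] := (unit_GmP P).1 PG.
exists (exist _ (P : Gu T) (mem_set (unit_GuP _ PP))); split=> //.
by apply: VN; rewrite -DV; exists W.
Qed.

Lemma embed_idem p : p * p = p -> embed p * embed p = embed p.
Proof. by rewrite -embedM => ->. Qed.

(** * The equivalence of (ii) and (iii) under (LC) *)

Context (hT : LC T).

Lemma basic_neighbourhood Q (W : set (Gu T)) : unit_space (@Gm T) Q ->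
  Gu_base W -> W Q -> exists q, [/\ q * q = q, nonzero q &
    forall R, nonzero R -> prec R (embed q) -> W R].
Proof.
have [Z _ _] := hT.
move=> /unit_GmP[+ +] [x [n [xs [_ ->]]]] [+ +].
have [B [dB ->]] := class_surj Q.
move=> Bm BB /prec_embed[b0 Bb0 b0x] Bxs.
pose disj i b := forall z, prec z b -> prec z (xs i) -> is_zero z.
have [||b Bb bP] := @directed_lower_bound T B 'I_n disj dB.
- by move=> i a b ab bi z za; apply: bi; apply: prec_trans za ab.
- by move=> i; apply: (minimal_disjoint hT _ dB _ Bm); apply: Bxs.
have [c Bc [cb cb0]] := dB.2 _ _ Bb Bb0.
have [q [Bq qq qc]] := class_idem_sub _ dB BB _ Bc.
exists q; split=> // [q0|R R0 Rq].
  by apply: Bm.1; apply/is_zero_class => //; exists q.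
have qx : prec q x by apply: prec_trans qc _; apply: prec_trans cb0 b0x.
split=> [|i _]; first exact: (prec_trans Rq (embed_prec qx)).
(* If [R] were also below [xs i], it would contain a common precessor of [q] and [xs i], which is
   zero by the choice of [b]. *)
move=> Rxi; have [A [dA RE]] := class_surj R.
move: R0 Rq Rxi; rewrite RE => R0 /prec_embed[a Aa aq] /prec_embed[a' Aa' ai].
have [d Ad [da da']] := dA.2 _ _ Aa Aa'.
apply: R0; apply/is_zero_class => //; exists d => //; apply: (bP i).
  by apply: prec_trans da _; apply: prec_trans aq _; apply: prec_trans qc cb.
exact: prec_trans da' ai.
Qed.

Lemma spanned_minimal :
  (forall p q, p * p = p -> q * q = q -> nonzero p -> spanned p q) ->
  minimal_groupoid (@Gm T).
Proof.
have [Z _ _] := hT; move=> h; apply/Gm_minimalP => P Q PU QU W bW WQ.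
have [q [qq q0 qW]] := basic_neighbourhood _ _ QU bW WQ.
have /unit_GmP[Pm PP] := PU; have [A [dA PE]] := class_surj P.
have [[a0 Aa0] fA] := dA.
have [a [Aa aa _]] : exists a, [/\ A a, a * a = a & prec a a0].
  by apply: (class_idem_sub _ dA) => //; rewrite -PE.
have [s [sq sa]] := h _ _ qq aa q0.
(* Otherwise [A] contains a nonzero precessor [c] of [a] that has only zero in common with every
   [x * x^-1], contrary to the covering of [a]. *)
have [x xs Px] : exists2 x, x \in s & prec P (embed (x * x^-1)).
  apply: contrapT => nP.
  pose disj (i : 'I_(size s)) b := forall z, prec z b ->
    prec z (tnth (in_tuple s) i * (tnth (in_tuple s) i)^-1) -> is_zero z.
  have [||b Ab bP] := @directed_lower_bound T A _ disj dA.
  - by move=> i b c bc ci z zb; apply: ci; apply: prec_trans zb bc.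
  - move=> i; apply: (minimal_disjoint hT _ dA); first by rewrite -PE.
    rewrite -PE => Pi; apply: nP.
    by exists (tnth (in_tuple s) i) => //; apply: mem_tnth.
  have [c Ac [cb ca]] := fA _ _ Ab Aa.
  have c0 : nonzero c.
    by move=> c0; apply: Pm.1; rewrite PE; apply/is_zero_class => //; exists c.
  have [z [z0 [x xs [zc zx]]]] := sa _ ca c0.
  have xs' : (index x s < size s)%N by rewrite index_mem.
  apply: z0; apply: (bP (Ordinal xs')); first exact: prec_trans zc cb.
  by rewrite (tnth_nth x) /= nth_index.
rewrite embedM embedV in Px.
(* The translate of [P] by [x^-1] has source [P] because [P] lies below [x * x^-1]; its range lies
   below [x^-1 * x], hence below [q]. *)
have XP : ((embed x)^-1 * P)^-1 * ((embed x)^-1 * P) = P.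
  rewrite sinvM sinvK (idem_sinv PP).
  have -> : P * embed x * ((embed x)^-1 * P) =
    P * (embed x * (embed x)^-1 * P) by rewrite !mulgA.
  by rewrite (idem_mul_precE _ _ (mulxV_idem _) Px) PP.
set X := (embed x)^-1 * P in XP.
have Xm : minimal_elt X by apply: minimal_idem_source; rewrite XP.
exists (X * X^-1); first by apply/orbit_GmP => //; exists X.
apply: qW; first by case: (minimal_eltM _ Xm (minimal_eltV Xm)); rewrite ?sinvK.
apply: (@prec_trans _ (embed (x^-1 * x))); last exact/embed_prec/sq.
rewrite /X embedM embedV sinvM sinvK (idem_sinv PP).
have -> : (embed x)^-1 * P * (P * embed x) = (embed x)^-1 * (P * P) * embed x.
  by rewrite !mulgA.
rewrite PP; have := conj_prec (embed x)^-1 _ _ Px.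
by rewrite sinvK !mulgA mulVgV.
Qed.

(* Quasi-compactness: an ultrafilter F on the minimal units containing U_q
   converges to the class of all idempotents e with U_e in F. *)
Lemma ultra_limit (F : set_system (Gu T)) q : UltraFilter F ->
  F (unit_space (@Gm T)) -> q * q = q -> F (Gu_cone q) ->
  exists2 Q, unit_space (@Gm T) Q &
    forall x, Gu_cone x (Q : Gu T) <-> F (Gu_cone x).
Proof.
move=> FU FG qq Fq; have [Z _ _] := hT.
pose A := [set e | e * e = e /\ F (Gu_cone e)].
have coneM (e f : T) : e * e = e -> f * f = f ->
    Gu_cone e `&` Gu_cone f `<=` Gu_cone (e * f).
  move=> ee ff X [/= Xe Xf]; rewrite /Gu_cone /= embedM.
  exact: (prec_idem_mul _ _ _ (embed_idem _ ee) Xe Xf).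
have dA : directed A.
  split=> [|e f [ee Fe] [ff Ff]]; first by exists q.
  exists (e * f); first split; first exact: idemM.
    by apply: filterS (filterI Fe Ff); apply: coneM.
  by split; [apply: prec_idem_mull (prec_refl _)|apply: mul_idem_prec].
have AA : class dA * class dA = class dA.
  rewrite class_mulE; apply/classP; split=> [e Ae|_ [e [ee Fe] [f [ff Ff] <-]]].
    by exists e => //; exists e => //; exists e => //; have [] := Ae.
  by exists (e * f) => //; have [_ /(_ _ _ (conj ee Fe) (conj ff Ff))] := dA;
    split; [apply: idemM|apply: filterS (filterI Fe Ff); apply: coneM].
have coneP x : Gu_cone x (class dA : Gu T) <-> F (Gu_cone x).
  split=> [/prec_embed[e [ee Fe] ex]|Fx].
    by apply: filterS Fe; apply: Gu_cone_le.
  (* An idempotent [e] below [x] is also below [x^-1 * x], since [e = e^-1 * e]. On units, the cone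
     of [x] is therefore the cone of the idempotent [m]. *)
  have [m [mx mxx mP]] := LC_meet hT x (x^-1 * x).
  have mm := prec_idem _ _ (mulVx_idem x) mxx.
  apply/prec_embed; exists m => //; split=> //.
  apply: filterS (filterI FG Fx) => P [/unit_GmP[_]].
  have [B [dB ->]] := class_surj P => BB /prec_embed[b Bb bx].
  have [e [Be ee eb]] := class_idem_sub _ dB BB _ Bb.
  have ex := prec_trans eb bx.
  apply/prec_embed; exists e => //; apply: mP => //.
  have := prec_mul (prec_sinv ex) ex; by rewrite (idem_sinv ee) ee.
(* By [coneP] and the ultrafilter property, every basic neighbourhood of [class dA] belongs to [F]
   and so meets the minimal units. *)
exists (class dA) => //; apply: (LC_closed hT) => // W [x [n [xs [_ ->]]]].
move=> [/coneP Fx Qxs].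
have Fxs : F (\bigcap_i ~` Gu_cone (xs i)).
  have /filter_forall Fall i : F (~` Gu_cone (xs i)).
    by have [/coneP/(Qxs i I)|] := in_ultra_setVsetC (Gu_cone (xs i)) FU.
  by apply: filterS Fall => X Xxs i _; apply: Xxs.
by have [P [[]]] := filter_ex (filterI (filterI FG Fx) Fxs); exists P.
Qed.

Lemma minimal_spanned : minimal_groupoid (@Gm T) ->
  forall p q, p * p = p -> q * q = q -> nonzero p -> spanned p q.
Proof.
have [Z _ _] := hT; move=> /Gm_minimalP Gmin p q pp qq p0.
apply: contrapT => npq.
pose C (s : seq T) : set (Gu T) :=
  [set P | [/\ unit_space (@Gm T) P, Gu_cone q P &
     forall x, x \in s -> ~ Gu_cone (x * x^-1) P]].
pose D (s : seq T) := forall x, x \in s -> prec (x^-1 * x) p.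
pose F0 : set_system (Gu T) := [set S | exists2 s, D s & C s `<=` S].
have FF : ProperFilter F0.
  apply: Build_ProperFilter.
    (* If [C s] were empty, a minimal class below [y] would lie below some [x * x^-1] with [x] in
       [s], and [s] would span [q]. *)
    move=> [s Ds Cs]; apply: npq; exists s; split=> // y yq y0.
    apply: contrapT => ny; have [X Xm Xy] := minimal_below y Z y0.
    apply: (Cs X); split.
    - apply/unit_GmP; split=> //; apply: prec_idem Xy.
      exact/embed_idem/(prec_idem _ _ qq yq).
    - exact: prec_trans Xy (embed_prec yq).
    - move=> x xs; move: Xm Xy; have [A [dA ->]] := class_surj X.
      move=> Am /prec_embed[a Aa ay] /prec_embed[b Ab bx].
      have [c Ac [ca cb]] := dA.2 _ _ Aa Ab.
      apply: ny; exists c; split.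
        by move=> c0; apply: Am.1; apply/is_zero_class => //; exists c.
      by exists x => //; split; [apply: prec_trans ca ay|
        apply: prec_trans cb bx].
  split; first by exists [::].
    move=> S S' [s Ds Cs] [s' Ds' Cs']; exists (s ++ s').
      by move=> x; rewrite mem_cat => /orP[/Ds|/Ds'].
    move=> P [PG Pq Pss]; split; [apply: Cs|apply: Cs']; split=> // x xs.
      by apply: Pss; rewrite mem_cat xs.
    by apply: Pss; rewrite mem_cat xs orbT.
  by move=> S S' SS [s Ds Cs]; exists s => //; apply: subset_trans SS.
have [F [FU F0F]] := ultraFilterLemma FF.
have [||P PG PF] := ultra_limit F q FU _ qq.
- by apply: F0F; exists [::] => // P [].
- by apply: F0F; exists [::] => // P [].
have [Q Qm Qp] := minimal_below p Z p0.
have QG : unit_space (@Gm T) Q.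
  by apply/unit_GmP; split=> //; apply: prec_idem Qp; apply: embed_idem.
have [|//|R /orbit_GmP[]] := Gmin P Q PG QG (Gu_cone p).
- exists p, 0%N, (fun=> p); split; first by case.
  by apply/seteqP; split=> [Y Yp|Y []//]; split=> // -[].
- by have /unit_GmP[] := PG.
move=> X XP -> /=; have [A [dA XA]] := class_surj X.
rewrite /Gu_cone /= XA class_invE class_mulE.
move=> /prec_embed[_ [a Aa [_ [b Ab <-] <-]] abp].
(* As [c * c^-1] is below [p], the list [[:: c^-1]] is admissible and [F] contains the complement of
   the cone of [c^-1 * c]. But [P = X^-1 * X] lies in that cone, so [F] contains the cone too. *)
have [c Ac [ca cb]] := dA.2 _ _ Aa Ab.
have cp : prec (c * c^-1) p.
  by apply: prec_trans abp; apply: prec_mul => //; apply: prec_sinv.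
have Xc : prec X (embed c) by rewrite XA; apply/prec_embed; exists c.
have /PF Fc : Gu_cone (c^-1 * c^-1^-1) (P : Gu T).
  rewrite sinvK /Gu_cone /= -XP embedM embedV.
  by apply: prec_mul => //; apply: prec_sinv.
have FnC : F (~` Gu_cone (c^-1 * c^-1^-1)).
  apply: F0F; exists [:: c^-1].
    by move=> x; rewrite inE => /eqP ->; rewrite sinvK.
  by move=> S [_ _ /(_ c^-1)]; rewrite inE eqxx; apply.
by have [S []] := filter_ex (filterI Fc FnC).
Qed.

End Minimality.

Theorem lemma7p8 (T : invSemigroupType) (hT : LC T) :
  let cond_i := forall I : set T,
    I `<=` @idempotents T -> I !=set0 -> covered_closed I -> invariant_set I ->
    I = [set z | is_zero z] \/ I = @idempotents T in
  let cond_ii := forall p q : T,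
    idempotents p -> idempotents q -> nonzero p ->
    exists (n : nat) (x : 'I_n.+1 -> T),
      (forall j, prec (sinv (x j) * x j) p) /\
      covered q (fun j => x j * sinv (x j)) in
  let cond_iii := minimal_groupoid (@Gm T) in
  (cond_i <-> cond_ii) /\ (cond_ii <-> cond_iii).
Proof.
move=> cond_i cond_ii cond_iii.
have iiP : cond_ii <->
    forall p q : T, p * p = p -> q * q = q -> nonzero p -> spanned p q.
  by split=> h p q pp qq p0; apply/(spannedP p q pp); apply: h.
split; first exact: iff_trans closed_invariant_trivialP (iff_sym iiP).
apply: (iff_trans iiP).
by split; [apply: spanned_minimal|apply: minimal_spanned].
Qed.
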